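(* Let $I\subseteq\mathbb{Q}\cap[0,1]$ be a finite set and $P$ a finite set of propositional letters. Then the canonical space for $\Sigma_H$ (one agent) over the restricted language, that is, the set of all maximally $\Sigma_H$-consistent sets of formulas among the formulas (of arbitrary finite depth) whose propositional letters are in $P$ and whose probability indices are in $I$, is finite.
   Context: Language $\mathcal{L}$ (one agent): formulas are given by $\phi ::= p \mid \neg\phi \mid \phi_1\wedge\phi_2 \mid L_r\phi$, with $p$ a propositional letter and $r\in\mathbb{Q}\cap[0,1]$. A logic is a set of formulas containing all propositional tautologies and closed under modus ponens and uniform substitution. $\Sigma_H$ is the smallest logic containing (A1) $L_0\phi$; (A2) $L_r\top$; (A3) $L_r(\phi\wedge\psi)\wedge L_t(\phi\wedge\neg\psi)\to L_{r+t}\phi$ for $r+t\le 1$; (A4) $\neg L_r(\phi\wedge\psi)\wedge\neg L_s(\phi\wedge\neg\psi)\to\neg L_{r+s}\phi$ for $r+s\le1$; (A5) $L_r\phi\to\neg L_s\neg\phi$ for $r+s>1$; $(4_p)$ $L_r\phi\to L_1L_r\phi$; $(5_p)$ $\neg L_r\phi\to L_1\neg L_r\phi$; and closed under (DIS): from $\phi\leftrightarrow\psi$ infer $L_r\phi\leftrightarrow L_r\psi$; and (ARCH): if $\gamma\to L_s\phi$ is a theorem for all $s<r$, then $\gamma\to L_r\phi$ is a theorem. All indices are rationals in $[0,1]$. A finite set of formulas is $\Sigma_H$-consistent if the negation of its conjunction is not in $\Sigma_H$; an arbitrary set is $\Sigma_H$-consistent if all its finite subsets are; a set of formulas of a sublanguage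 is maximally consistent in it if it is consistent and no properly larger set of formulas of that sublanguage is. *)

(* Defs.v *)
From HB Require Import structures.
From mathcomp Require Import all_boot all_order all_algebra.
From mathcomp Require Import finmap.
From mathcomp Require Import boolp classical_sets functions cardinality.

Set Implicit Arguments.
Unset Strict Implicit.
Unset Printing Implicit Defensive.

Import Order.TTheory GRing.Theory Num.Theory.

Local Open Scope classical_set_scope.
Local Open Scope ring_scope.

(* Probability indices: the rationals in [0, 1]. *)
Record pindex := PIndex { pval :> rat; _ : 0 <= pval <= 1 }.
HB.instance Definition _ := [isSub for pval].
HB.instance Definition _ := [Choice of pindex by <:].

Definition pindex0 : pindex := @PIndex 0 isT.
Definition pindex1 : pindex := @PIndex 1 isT.

Inductive form (At : Type) : Type :=
| Var of At
| Neg of form At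
| And of form At & form At
| L of pindex & form At.

(* Classical decidable equality and choice, so that {fset form At} makes sense. *)
HB.instance Definition _ (At : Type) := gen_eqMixin (form At).
HB.instance Definition _ (At : Type) := gen_choiceMixin (form At).

Definition Imp (At : Type) (phi psi : form At) : form At :=
  Neg (And phi (Neg psi)).

Definition Iff (At : Type) (phi psi : form At) : form At :=
  And (Imp phi psi) (Imp psi phi).

(* The grammar has no constant, so the set of letters has to be nonempty for
   Top to be expressible; DIS makes the choice of the letter irrelevant. *)
Definition Top (At : pointedType) : form At :=
  Neg (And (Var point) (Neg (Var point))).

(* Boolean evaluation in which letters and formulas L r phi are atoms. *)
Fixpoint beval (At : Type) (v : form At -> bool) (phi : form At) : bool :=
  match phi with
  | Var _ | L _ _ => v phi
  | Neg psi => ~~ beval v psi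
  | And psi chi => beval v psi && beval v chi
  end.

(* Tautologies of the whole language, i.e. including those built from
   L-formulas. *)
Definition tautology (At : Type) (phi : form At) : Prop :=
  forall v : form At -> bool, beval v phi.

Fixpoint subst (At : Type) (sigma : At -> form At) (phi : form At) : form At :=
  match phi with
  | Var p => sigma p
  | Neg psi => Neg (subst sigma psi)
  | And psi chi => And (subst sigma psi) (subst sigma chi)
  | L r psi => L r (subst sigma psi)
  end.

(* In A3 and A4 the side condition r + t <= 1 is the existence of the index u
   with value r + t. *)
Inductive SigmaH (At : pointedType) : form At -> Prop :=
| SigmaH_taut phi : tautology phi -> SigmaH phi
| SigmaH_MP phi psi : SigmaH (Imp phi psi) -> SigmaH phi -> SigmaH psi
| SigmaH_subst sigma phi : SigmaH phi -> SigmaH (subst sigma phi)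
| SigmaH_A1 phi : SigmaH (L pindex0 phi)
| SigmaH_A2 r : SigmaH (L r (Top At))
| SigmaH_A3 (r t u : pindex) phi psi :
    pval u = pval r + pval t ->
    SigmaH (Imp (And (L r (And phi psi)) (L t (And phi (Neg psi)))) (L u phi))
| SigmaH_A4 (r s u : pindex) phi psi :
    pval u = pval r + pval s ->
    SigmaH (Imp (And (Neg (L r (And phi psi))) (Neg (L s (And phi (Neg psi)))))
                (Neg (L u phi)))
| SigmaH_A5 (r s : pindex) phi :
    1 < pval r + pval s ->
    SigmaH (Imp (L r phi) (Neg (L s (Neg phi))))
| SigmaH_4p r phi : SigmaH (Imp (L r phi) (L pindex1 (L r phi)))
| SigmaH_5p r phi : SigmaH (Imp (Neg (L r phi)) (L pindex1 (Neg (L r phi))))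
| SigmaH_DIS r phi psi :
    SigmaH (Iff phi psi) -> SigmaH (Iff (L r phi) (L r psi))
| SigmaH_ARCH (r : pindex) gamma phi :
    (forall s : pindex, pval s < pval r -> SigmaH (Imp gamma (L s phi))) ->
    SigmaH (Imp gamma (L r phi)).

Definition conjunction (At : pointedType) (D : {fset form At}) : form At :=
  \big[@And At / Top At]_(phi <- D) phi.

Definition fconsistent (At : pointedType) (D : {fset form At}) : Prop :=
  ~ SigmaH (Neg (conjunction D)).

Definition consistent (At : pointedType) (G : set (form At)) : Prop :=
  forall D : {fset form At}, [set` D] `<=` G -> fconsistent D.

Definition max_consistent_in (At : pointedType) (Lang G : set (form At)) : Prop :=
  [/\ G `<=` Lang, consistent G
    & forall G', G `<` G' -> G' `<=` Lang -> ~ consistent G'].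

(* Membership in the sublanguage with letters in P and indices in I. *)
Fixpoint restricted (At : Type) (P : set At) (I : set pindex) (phi : form At) : Prop :=
  match phi with
  | Var p => P p
  | Neg psi => restricted P I psi
  | And psi chi => restricted P I psi /\ restricted P I chi
  | L r psi => I r /\ restricted P I psi
  end.

Definition canonical_space (At : pointedType) (P : set At) (I : set pindex) :
    set (set (form At)) :=
  [set G | max_consistent_in [set phi | restricted P I phi] G].

(* Main.v *)
Require Import Defs.
From mathcomp Require Import all_boot all_order all_algebra.
From mathcomp Require Import finmap.
From mathcomp Require Import boolp classical_sets functions cardinality.
(* The algebra library also defines a form; here it is the type of formulas. *)
Require Import Defs.

Set Implicit Arguments.
Unset Strict Implicit.
Unset Printing Implicit Defensive.

Import Order.TTheory GRing.Theory Num.Theory.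

Local Open Scope classical_set_scope.
Local Open Scope ring_scope.

(** Introspection collapses nested probability operators.  Let [G] be a
    maximally consistent set of the restricted language.  It decides every
    formula [L s psi] of that language, so by (4p) and (5p) it gives
    probability 1 to whichever of [L s psi] and [Neg (L s psi)] it contains.
    Hence, for the purposes of [G], a formula [phi] agrees with probability 1
    with the propositional formula [flatten p G phi] in which each outermost
    [L s psi] is replaced by its truth value in [G] ([entails_L1_flatten]).
    The axioms make [L r] monotone along implications of probability 1
    ([SigmaH_L_monotone]), so [L r phi] is in [G] exactly when
    [L r (flatten p G phi)] is ([max_consistent_L_flatten]).  No index outside
    those of [phi] appears in this reduction, although index 1, which the
    sublanguage may lack, is used to prove it.

    By (DIS), membership of [L r beta] in [G] for a propositional [beta] depends
    only on [r] and on the set of valuations of the letters of [P] that make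
    [beta] true.  So [G] is determined by a [profile], consisting of the letters
    in [G] and of a set of pairs (index of [I], set of valuations); the
    structural induction is [profile_flatten].  There are finitely many
    profiles because [P] and [I] are finite. *)

(** * Propositional reasoning *)

Section CanonicalSpace.
Variable At : pointedType.
Implicit Types (phi psi : form At) (v : form At -> bool) (D : {fset form At}).

Local Ltac tautology_by_cases :=
  let v := fresh "v" in
  move=> v /=;
  repeat match goal with
  | |- context [beval v ?phi] => case: (beval v phi) => //=
  | |- context [v ?phi] => case: (v phi) => //=
  end.

(** Stated for an arbitrary set [T] closed under modus ponens because it serves
    three times: for the theorems, for the consequences of a set [G], and for
    the formulas to which [G] gives probability 1. *)
Lemma tautological_consequence (T : set (form At)) (s : seq (form At)) psi :
    (forall phi, tautology phi -> T phi) ->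
    (forall phi chi, T (Imp phi chi) -> T phi -> T chi) ->
    (forall v, all (beval v) s -> beval v psi) ->
    foldr (fun phi => and (T phi)) True s -> T psi.
Proof.
move=> Ttaut Tmp; elim: s psi => [|phi s IHs] psi /= spsi.
  by move=> _; apply: Ttaut => v; apply: spsi.
move=> [Tphi Ts]; apply: Tmp Tphi; apply: IHs Ts => v /= sv.
by have := spsi v; rewrite sv andbT; case: (beval v phi) => //= ->.
Qed.

Lemma SigmaH_consequence (s : seq (form At)) psi :
    (forall v, all (beval v) s -> beval v psi) ->
    foldr (fun phi => and (SigmaH phi)) True s -> SigmaH psi.
Proof.
exact: (tautological_consequence (@SigmaH_taut At) (@SigmaH_MP At)).
Qed.

Lemma beval_conjunction v D :
  beval v (conjunction D) = all (beval v) (enum_fset D).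
Proof.
rewrite /conjunction (big_morph (beval v) (op1 := andb) (id1 := true)) //=.
  by rewrite big_all.
by case: (v _).
Qed.

(** * Normality of the operators L *)

Lemma SigmaH_necessitation phi : SigmaH phi -> SigmaH (L pindex1 phi).
Proof.
move=> Hphi.
have phiT : SigmaH (Iff phi (Top At)).
  by apply: (@SigmaH_consequence [:: phi]) => //; tautology_by_cases.
apply: (@SigmaH_consequence [:: Iff (L pindex1 phi) (L pindex1 (Top At));
                                L pindex1 (Top At)]).
  by tautology_by_cases.
by do !split; [exact: SigmaH_DIS | exact: SigmaH_A2].
Qed.

(** For [t < r] the part of [phi] outside [psi] has probability 0, hence not
    [r - t], so by (A4) the part inside [psi] must have probability at least
    [t]; (ARCH) passes to the limit.  The argument cannot be run at [t = r],
    since (A5) refutes [L s] only for positive [s]. *)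
Lemma SigmaH_L_monotone (r : pindex) phi psi :
  SigmaH (Imp (L pindex1 (Imp phi psi)) (Imp (L r phi) (L r psi))).
Proof.
apply: (@SigmaH_consequence
  [:: Imp (And (L pindex1 (Imp phi psi)) (L r phi)) (L r psi)]).
  by tautology_by_cases.
split=> //; apply: SigmaH_ARCH => t tr.
have s01 : 0 <= pval r - pval t <= 1.
  rewrite subr_ge0 (ltW tr) /= lerBlDr.
  case: (r) => {tr}r /= /andP[_ r1]; case: (t) => {}t /= /andP[t0 _].
  by rewrite (le_trans r1)// lerDl.
pose s := PIndex s01.
apply: (@SigmaH_consequence
  [:: Imp (L pindex1 (Imp phi psi)) (Neg (L s (Neg (Imp phi psi))));
      Iff (L s (Neg (Imp phi psi))) (L s (And phi (Neg psi)));
      Imp (And (Neg (L t (And phi psi))) (Neg (L s (And phi (Neg psi)))))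
        (Neg (L r phi));
      Iff (L t (And phi psi)) (L t (And psi phi));
      L pindex0 (And psi (Neg phi));
      Imp (And (L t (And psi phi)) (L pindex0 (And psi (Neg phi)))) (L t psi)]).
  by tautology_by_cases.
do !split.
- by apply: SigmaH_A5; rewrite /= ltrDl subr_gt0.
- by apply/SigmaH_DIS/SigmaH_taut; tautology_by_cases.
- by apply: SigmaH_A4; rewrite /= addrC subrK.
- by apply/SigmaH_DIS/SigmaH_taut; tautology_by_cases.
- exact: SigmaH_A1.
- by apply: SigmaH_A3; rewrite /= addr0.
Qed.

(** * Consequences of a set of formulas *)

(** The conclusion may lie outside the sublanguage of [G]: the argument passes
    through formulas [L pindex1 psi] even when 1 is not an index of [G]. *)
Definition entails (G : set (form At)) : set (form At) :=
  [set phi | exists2 D : {fset form At},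
     [set` D] `<=` G & SigmaH (Imp (conjunction D) phi)].

Section Entails.
Variable G : set (form At).

Lemma entails_SigmaH phi : SigmaH phi -> entails G phi.
Proof.
move=> Hphi; exists fset0; first by move=> x /=; rewrite inE.
by apply: (@SigmaH_consequence [:: phi]) => // v /= /andP[-> _]; rewrite andbF.
Qed.

Lemma entails_mem phi : G phi -> entails G phi.
Proof.
move=> Gphi; exists [fset phi]%fset => [x /=|]; first by rewrite inE => /eqP->.
apply: SigmaH_taut => v; rewrite /= beval_conjunction.
by apply/negP => /andP[/allP/(_ phi)]; rewrite inE eqxx => /(_ isT) ->.
Qed.

Lemma entails_MP phi psi :
  entails G (Imp phi psi) -> entails G phi -> entails G psi.
Proof.
move=> [D DG HD] [E EG HE]; exists (D `|` E)%fset.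
  by move=> x; rewrite /= in_fsetU => /orP[/DG|/EG].
apply: (@SigmaH_consequence [:: Imp (conjunction D) (Imp phi psi);
                                Imp (conjunction E) phi]) => // v.
rewrite /= !beval_conjunction.
have [/allP DEv|//] := boolP (all _ (enum_fset (D `|` E)%fset)).
have -> : all (beval v) (enum_fset D).
  by apply/allP => x xD; apply: DEv; rewrite in_fsetU xD.
have -> : all (beval v) (enum_fset E).
  by apply/allP => x xE; apply: DEv; rewrite in_fsetU xE orbT.
by case: (beval v phi) => //=; case: (beval v psi).
Qed.

Lemma entails_consequence (s : seq (form At)) psi :
    (forall v, all (beval v) s -> beval v psi) ->
    foldr (fun phi => and (entails G phi)) True s -> entails G psi.
Proof.
apply: tautological_consequence; last exact: entails_MP.
by move=> phi /SigmaH_taut/entails_SigmaH.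
Qed.

Lemma entails_L_monotone (r : pindex) phi psi :
    entails G (L pindex1 (Imp phi psi)) -> entails G (L r phi) ->
  entails G (L r psi).
Proof.
move=> H; apply/entails_MP/(entails_MP _ H)/entails_SigmaH.
exact: SigmaH_L_monotone.
Qed.

Lemma entails_L1_consequence (s : seq (form At)) psi :
    (forall v, all (beval v) s -> beval v psi) ->
    foldr (fun phi => and (entails G (L pindex1 phi))) True s ->
  entails G (L pindex1 psi).
Proof.
apply: (tautological_consequence (T := [set phi | entails G (L pindex1 phi)])).
  by move=> phi /SigmaH_taut/SigmaH_necessitation/entails_SigmaH.
by move=> phi chi; apply: entails_L_monotone.
Qed.

Lemma consistent_entails phi :
  consistent G -> entails G phi -> entails G (Neg phi) -> False.
Proof.
move=> cG Gphi GNphi.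
have [D DG HD] : entails G (Neg (Top At)).
  by apply: (entails_consequence (s := [:: phi; Neg phi])) => //;
     tautology_by_cases.
apply: (cG D DG); apply: (SigmaH_consequence (s := [:: _])) (conj HD I).
by tautology_by_cases.
Qed.

End Entails.

(** * Maximally consistent sets of a sublanguage *)

Section MaximallyConsistent.
Variables Lang G : set (form At).
Hypothesis maxG : max_consistent_in Lang G.

(** Adding [phi] to [G] gives a larger set, hence a finite inconsistent one;
    what that finite set has besides [phi] lies in [G] and refutes [phi]. *)
Lemma max_consistent_entailsN phi :
  Lang phi -> ~ G phi -> entails G (Neg phi).
Proof.
case: maxG => GLang cG Gmax Lphi GNphi.
have GG' : G `<` G `|` [set phi].
  by split=> [x|/(_ phi)]; [left | move=> sub; apply/GNphi/sub; right].
have /existsNP[D /not_implyP[DG /contrapT HD]] : ~ consistent (G `|` [set phi]).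
  by apply: Gmax GG' _ => x [/GLang//|->].
exists (D `\ phi)%fset.
  by move=> x; rewrite /= !inE => /andP[/eqP xphi /DG[]].
apply: (SigmaH_consequence (s := [:: _])) (conj HD I) => v /=.
rewrite !beval_conjunction andbT negbK => /allPn[x xD vx].
apply/negP => /andP[/allP Dv vphi].
have [xphi|xphi] := eqVneq x phi; first by rewrite xphi vphi in vx.
by move: vx; rewrite Dv // !inE xphi.
Qed.

Lemma max_consistent_entails phi : Lang phi -> entails G phi -> G phi.
Proof.
move=> Lphi Gphi; apply: contrapT => /(max_consistent_entailsN Lphi).
by case: maxG => _ cG _; apply: consistent_entails.
Qed.

End MaximallyConsistent.

(** * Eliminating nested operators *)

(** The letter [p] serves to write truth and falsity inside a sublanguage
    containing [p]; [Top] uses a letter that may be outside it. *)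
Fixpoint flatten (p : At) (G : set (form At)) phi : form At :=
  match phi with
  | Var q => Var q
  | Neg psi => Neg (flatten p G psi)
  | And psi chi => And (flatten p G psi) (flatten p G chi)
  | L r psi => let bot := And (Var p) (Neg (Var p)) in
               if `[< G (L r psi) >] then Neg bot else bot
  end.

Lemma restricted_flatten (P : set At) (I : set pindex) p G phi : P p ->
  restricted P I phi -> restricted P set0 (flatten p G phi).
Proof.
by move=> Pp; elim: phi => //= [psi IH chi IH' []|r psi _ _];
  [split; auto | case: ifP].
Qed.

Lemma restricted_sub (P : set At) (I J : set pindex) phi : I `<=` J ->
  restricted P I phi -> restricted P J phi.
Proof.
move=> IJ; elim: phi => //= [psi IH chi IH' []|r psi IH []]; split; auto.
Qed.

(** Every formula contains a letter, so a restricted formula yields a letter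
    of [P]. *)
Lemma restricted_letter (P : set At) (I : set pindex) phi :
  restricted P I phi -> P (get P).
Proof.
by elim: phi => //= [q Pq|psi + chi _ []|r psi + []];
  [apply: getI Pq | auto | auto].
Qed.

Section Canonical.
Variables (P : set At) (I : set pindex) (G : set (form At)).
Hypothesis GPI : canonical_space P I G.

(** At an outermost [L r psi], introspection turns what [G] decides about it
    into a formula of probability 1; the connectives need only that these
    formulas are closed under tautological consequence. *)
Lemma entails_L1_flatten p phi : restricted P I phi ->
  entails G (L pindex1 (Iff phi (flatten p G phi))).
Proof.
elim: phi => [q _|psi IH /IH Hpsi|psi IHpsi chi IHchi [/IHpsi Hp /IHchi Hc]
             |r psi _ rpsi] /=.
- by apply: (entails_L1_consequence (s := [::])) => //; tautology_by_cases.
- apply: (entails_L1_consequence (s := [:: _])) (conj Hpsi Logic.I).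
  by tautology_by_cases.
- apply: (entails_L1_consequence (s := [:: _; _])) (conj Hp (conj Hc Logic.I)).
  by tautology_by_cases.
- case: asboolP => [/entails_mem Gr|/(max_consistent_entailsN GPI rpsi) Gr].
    have G1 := entails_MP (entails_SigmaH G (SigmaH_4p r psi)) Gr.
    apply: (entails_L1_consequence (s := [:: _])) (conj G1 Logic.I).
    by tautology_by_cases.
  have G1 := entails_MP (entails_SigmaH G (SigmaH_5p r psi)) Gr.
  apply: (entails_L1_consequence (s := [:: _])) (conj G1 Logic.I).
  by tautology_by_cases.
Qed.

Lemma max_consistent_L_flatten p (r : pindex) phi : P p ->
  restricted P I (L r phi) -> G (L r phi) <-> G (L r (flatten p G phi)).
Proof.
move=> Pp [Ir rphi]; have H := entails_L1_flatten p rphi.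
have rflat : restricted P I (flatten p G phi).
  exact/(restricted_sub (@sub0set _ I))/restricted_flatten/rphi.
split=> /entails_mem Gr; apply: (max_consistent_entails GPI) => //=;
  apply: entails_L_monotone Gr;
  apply: (entails_L1_consequence (s := [:: _])) (conj H Logic.I);
  by tautology_by_cases.
Qed.

End Canonical.

(** * Profiles *)

(** The value on formulas [L r phi] is arbitrary: only propositional formulas
    are evaluated this way. *)
Definition letter_valuation (V : set At) (phi : form At) : bool :=
  if phi is Var q then `[< V q >] else false.

Definition truth_set (P : set At) phi : set (set At) :=
  [set V | V `<=` P /\ beval (letter_valuation V) phi].

Lemma beval_propositional (P : set At) v phi : restricted P set0 phi ->
  beval v phi = beval (letter_valuation [set q | P q /\ v (Var q)]) phi.
Proof.
elim: phi => //= [q Pq|psi IH /IH->//|psi IH chi IH' [/IH-> /IH'->//]|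
                  r psi _ []//].
by apply/idP/asboolP => [|[]].
Qed.

Lemma truth_set_tautology (P : set At) phi psi :
    restricted P set0 phi -> restricted P set0 psi ->
    truth_set P phi = truth_set P psi ->
  tautology (Iff phi psi).
Proof.
move=> rphi rpsi eq_t v; pose V := [set q | P q /\ v (Var q)].
have VP : V `<=` P by move=> q [].
have : beval v phi = beval v psi.
  rewrite (beval_propositional v rphi) (beval_propositional v rpsi).
  apply/idP/idP => H.
    by have [] : truth_set P psi V by rewrite -eq_t.
  by have [] : truth_set P phi V by rewrite eq_t.
by rewrite /= => ->; case: (beval v psi).
Qed.

Definition profile (P : set At) (I : set pindex) (G : set (form At)) :
    set At * set (pindex * set (set At)) :=
  ([set q | P q /\ G (Var q)],
   [set x | I x.1 /\
      exists beta, [/\ restricted P set0 beta,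
                       x.2 = truth_set P beta & G (L x.1 beta)]]).

Lemma profile_propositional (P : set At) (I : set pindex) G (r : pindex) phi :
    canonical_space P I G -> I r -> restricted P set0 phi ->
  G (L r phi) <-> (profile P I G).2 (r, truth_set P phi).
Proof.
move=> GPI Ir rphi; split=> [Gphi|[_ [psi [rpsi eq_t Gpsi]]]].
  by split=> //; exists phi.
apply: (max_consistent_entails GPI) => /=.
  by split=> //; exact: restricted_sub (@sub0set _ I) rphi.
have := truth_set_tautology rphi rpsi eq_t.
move=> /SigmaH_taut/(SigmaH_DIS r)/(entails_SigmaH G) GE.
apply: (entails_consequence (s := [:: _; _]))
  (conj GE (conj (entails_mem Gpsi) Logic.I)).
by tautology_by_cases.
Qed.

(** The equality of flattenings is what the induction needs at [L r phi]:
    membership of [L r phi] is read off from the flattening of [phi], which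
    depends on the operators nested inside [phi]. *)
Lemma profile_flatten (P : set At) (I : set pindex) G G' phi :
    canonical_space P I G -> canonical_space P I G' ->
    profile P I G = profile P I G' -> restricted P I phi ->
  (G phi <-> G' phi) /\ flatten (get P) G phi = flatten (get P) G' phi.
Proof.
move=> GPI G'PI eqp.
have Gneg H psi : canonical_space P I H -> restricted P I psi ->
    H (Neg psi) <-> ~ H psi.
  move=> HPI rpsi; split=> [/entails_mem HN /entails_mem Hpsi|].
    by case: HPI => _ cH _; exact: consistent_entails HN.
  move=> /(max_consistent_entailsN HPI rpsi).
  by move=> /(max_consistent_entails HPI); apply.
have Gand H psi chi : canonical_space P I H -> restricted P I (And psi chi) ->
    H (And psi chi) <-> H psi /\ H chi.
  move=> HPI rpc; case: (rpc) => rpsi rchi; split=> [/entails_mem HA|].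
    by split; apply: (max_consistent_entails HPI) => //;
      apply: (entails_consequence (s := [:: _])) (conj HA Logic.I);
      tautology_by_cases.
  move=> [/entails_mem Hp /entails_mem Hc].
  apply: (max_consistent_entails HPI) => //.
  apply: (entails_consequence (s := [:: _; _])) (conj Hp (conj Hc Logic.I)).
  by tautology_by_cases.
elim: phi => [q Pq|psi IH rpsi|psi IHpsi chi IHchi rpc|r psi IH rLpsi].
- split=> //; have := congr1 (fun x => x.1 q) eqp; rewrite /= => eqq.
  split=> Gq; first by have [] : P q /\ G' (Var q) by rewrite -eqq.
  by have [] : P q /\ G (Var q) by rewrite eqq.
- have [eqG eqf] := IH rpsi; split; last by rewrite /= eqf.
  by rewrite (Gneg G) // (Gneg G') // eqG.
- have [/IHpsi[eqG eqf] /IHchi[eqG' eqf']] := rpc.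
  split; last by rewrite /= eqf eqf'.
  by rewrite (Gand G) // (Gand G') // eqG eqG'.
- have [Ir rpsi] := rLpsi; have [_ eqf] := IH rpsi.
  have Pp := restricted_letter rpsi.
  have eqL : G (L r psi) <-> G' (L r psi).
    rewrite (max_consistent_L_flatten GPI Pp rLpsi).
    rewrite (max_consistent_L_flatten G'PI Pp rLpsi) -eqf.
    have rflat := restricted_flatten G Pp rpsi.
    by rewrite !(profile_propositional _ Ir rflat) // eqp.
  by split=> //=; rewrite (asbool_equiv_eq eqL).
Qed.

Lemma profile_inj (P : set At) (I : set pindex) :
  {in canonical_space P I &, injective (profile P I)}.
Proof.
move=> G G' /set_mem GPI /set_mem G'PI eqp; apply/seteqP.
have [GLang _ _] := GPI; have [G'Lang _ _] := G'PI.
by split=> phi Hphi;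
  [have [H _] := profile_flatten GPI G'PI eqp (GLang _ Hphi)
  |have [H _] := profile_flatten GPI G'PI eqp (G'Lang _ Hphi)]; apply/H.
Qed.

End CanonicalSpace.

(** * Finiteness *)

Lemma finite_powerset (T : choiceType) (A : set T) :
  finite_set A -> finite_set [set B | B `<=` A].
Proof.
move=> /finite_fsetP[X ->].
apply: (@sub_finite_set _ _ ((fun Y => [set` Y]) @` [set` fpowerset X])).
  move=> B BX; exists (fset_set B); last first.
    by rewrite fset_setK //; exact: finite_subfset BX.
  rewrite /= fpowersetE; apply/fsubsetP => x.
  by rewrite in_fset_set; [move=> /set_mem/BX | exact: finite_subfset BX].
exact/finite_image/finite_fset.
Qed.

Theorem theorem3p26 (At : pointedType) (I : set pindex) (P : set At)
  (finI : finite_set I) (finP : finite_set P) :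
  finite_set (canonical_space P I).
Proof.
rewrite -(eq_finite_set (inj_card_eq (@profile_inj At P I))).
apply: (@sub_finite_set _ _
  ([set Q | Q `<=` P] `*`
   [set X | X `<=` I `*` [set S | S `<=` [set V | V `<=` P]]])).
  move=> _ [G _ <-]; split=> [q []//|[r S] /= [Ir [phi [_ -> _]]]].
  by split=> // V [].
apply: finite_setX; first exact: finite_powerset.
apply: finite_powerset; apply: finite_setX => //.
by do 2!apply: finite_powerset.
Qed.
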